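(* Let $a\in\mathbb{R}$, $\lambda\ge 0$, $\beta\in(0,1)$ and $p_{01},p_{11}\in(0,1]$, and assume $a^2(1-p_{01})<1$ and $p_{11}\ge p_{01}$. The optimal value function $\tilde{V}^{\beta}$ of the folded POMDP on $\mathbb{R}_+\times[0,1]$ described in the context satisfies: (A) For each $\tilde{b}\in[0,1]$, the function $\tilde{e}\mapsto\tilde{V}^{\beta}(\tilde{e},\tilde{b})$ is non-decreasing on $\mathbb{R}_+$. (B) For each $\tilde{e}\in\mathbb{R}_+$, the function $\tilde{b}\mapsto\tilde{V}^{\beta}(\tilde{e},\tilde{b})$ is non-increasing on $[0,1]$. (C) For all $\tilde{e}\in\mathbb{R}_+$ and all $x,y,z,\tilde{b}\in[0,1]$ such that $x\ge y$ and $z=\tilde{b}x+(1-\tilde{b})y$, $$(1-\tilde{b})\lambda+\tilde{b}\,\tilde{V}^{\beta}(\tilde{e},x)+(1-\tilde{b})\,\tilde{V}^{\beta}(\tilde{e},y)\ \ge\ \tilde{V}^{\beta}(\tilde{e},z).$$ (D) For each $\tilde{e}\in\mathbb{R}_+$ there exists a threshold $\tilde{b}^{\star}(\tilde{e})\in\mathbb{R}$ (possibly larger than $1$, meaning never transmit) such that for $\tilde{b}\in[0,1]$ it is optimal to transmit in state $(\tilde{e},\tilde{b})$ if $\tilde{b}\ge\tilde{b}^{\star}(\tilde{e})$ and optimal not to transmit if $\tilde{b}<\tilde{b}^{\star}(\tilde{e})$. Thus the optimal strategy corresponding to $\tilde{V}^{\beta}$ exhibits a threshold structure: transmit only when $\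tilde{b}\ge\tilde{b}^{\star}(\tilde{e})$.
   Context: Let $\mathbb{R}_+=[0,\infty)$, $\varphi(z)=e^{-z^2/2}/\sqrt{2\pi}$ and $\mathcal{T}(b):=b\,p_{11}+(1-b)\,p_{01}$. Here $p_{01},p_{11}$ are the probabilities that a two-state Markov (Gilbert–Elliott) channel is in the good state $1$ at the next step, given that it is currently in the bad state $0$, respectively the good state $1$. Folded POMDP: the state is $(\tilde{e},\tilde{b})\in\mathbb{R}_+\times[0,1]$ (error and belief), the action is $\tilde{u}\in\{0,1\}$ ($1$ = transmit), and the instantaneous cost is $\tilde{e}^2+\lambda\tilde{u}$. From state $(\tilde{e},\tilde{b})$ the next state is distributed as follows, with $w\sim\mathcal{N}(0,1)$ independent of the past: - if $\tilde{u}=0$: the next state is $(|a\tilde{e}+w|,\mathcal{T}(\tilde{b}))$; - if $\tilde{u}=1$: with probability $\tilde{b}$ it is $(|w|,p_{11})$, and with probability $1-\tilde{b}$ it is $(|a\tilde{e}+w|,p_{01})$. A policy chooses, at each time, the action as a measurable function of the history of states (and past actions). $\tilde{V}^{\beta}(\tilde{e},\tilde{b})$ is the minimum over policies of the expected infinite-horizon $\beta$-discounted cost $\mathbb{E}\sum_{t\ge0}\beta^t(\tilde{e}(t)^2+\lambda\tilde{u}(t))$ started from $(\tilde{e},\tilde{b})$. Define $$\tilde{Q}^{\beta}(\tilde{e},\tilde{b};0):=\tilde{e}^2+\beta\int_{0}^{\infty}\big[\varphi(y-a\tilde{e})+\varphi(y+a\tilde{e})\big]\tilde{V}^{\beta}(y,\mathcal{T}(\tilde{b}))\,dy,$$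 $$\tilde{Q}^{\beta}(\tilde{e},\tilde{b};1):=\tilde{e}^2+\lambda+\beta\tilde{b}\int_0^\infty 2\varphi(y)\tilde{V}^{\beta}(y,p_{11})\,dy+\beta(1-\tilde{b})\int_0^\infty\big[\varphi(y-a\tilde{e})+\varphi(y+a\tilde{e})\big]\tilde{V}^{\beta}(y,p_{01})\,dy.$$ An action $\tilde{u}$ is optimal in state $(\tilde{e},\tilde{b})$ if it minimizes $\tilde{Q}^{\beta}(\tilde{e},\tilde{b};\cdot)$ over $\{0,1\}$. *)

(* Defs.v *)
From mathcomp Require Import all_boot all_order all_algebra.
From mathcomp Require Import all_classical all_reals all_analysis.
From mathcomp Require Import measurable_realfun giry.

Set Implicit Arguments.
Unset Strict Implicit.
Unset Printing Implicit Defensive.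

Import Order.TTheory GRing.Theory Num.Theory.
Import numFieldNormedType.Exports.

Local Open Scope classical_set_scope.
Local Open Scope ring_scope.

(* A state is a pair (error, belief) : R * R.  For p01, p11 in [0, 1], the
   transitions below map [0, +oo[ x [0, 1] into itself, and only initial states
   in that set matter.  The action true means: transmit. *)

(* A history at time t: the t past (state, action) pairs, the most recent one
   first, and the current state. *)
Notation history R t := ((t.-tuple ((R * R) * bool) * (R * R))%type).

Record policy (R : realType) := Policy {
  action :> forall t, history R t -> bool ;
  measurable_action : forall t, measurable_fun setT (@action t) }.
Arguments action {R} _ t _.

Section folded_pomdp.
Context {R : realType}.
Variables (a lambda beta p01 p11 : R).

(* The belief at the next step given the belief b at the current step, when
   the channel has not been observed. *)
Definition belief_update (b : R) : R := b * p11 + (1 - b) * p01.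

(* n.1 is the Gaussian disturbance; n.2 tells whether the channel is good. *)
Definition next_state (s : R * R) (u : bool) (n : R * bool) : R * R :=
  if u then
    if n.2 then (`|n.1|, p11) else (`|a * s.1 + n.1|, p01)
  else (`|a * s.1 + n.1|, belief_update s.2).

Lemma measurable_next_state :
  measurable_fun setT
    (fun x : ((R * R) * bool) * (measurableTypeR R * bool) =>
       next_state x.1.1 x.1.2 x.2).
Proof.
set T := (X in @measurable_fun _ _ X _ _ _).
have mid : measurable_fun setT (fun w : measurableTypeR R => w : R).
  exact: (@measurable_id _ (measurableTypeR R)).
have mw : measurable_fun setT (fun x : T => x.2.1 : R).
  apply: (measurableT_comp mid).
  exact: measurableT_comp measurable_fst measurable_snd.
have ms : measurable_fun setT (fun x : T => x.1.1).
  exact: measurableT_comp measurable_fst measurable_fst.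
have ms1 : measurable_fun setT (fun x : T => x.1.1.1).
  exact: measurableT_comp measurable_fst ms.
have ms2 : measurable_fun setT (fun x : T => x.1.1.2).
  exact: measurableT_comp measurable_snd ms.
have me : measurable_fun setT (fun x : T => `|a * x.1.1.1 + (x.2.1 : R)|).
  apply: measurableT_comp => //; apply: measurable_funD => //.
  exact: measurable_funM.
apply: measurable_fun_ifT => /=.
- exact: measurableT_comp measurable_snd measurable_fst.
- apply: measurable_fun_ifT => /=.
  + exact: measurableT_comp measurable_snd measurable_snd.
  + apply: measurable_fun_pair => //; exact: measurableT_comp.
  + exact: measurable_fun_pair.
- apply: measurable_fun_pair => //.
  apply: measurable_funD; apply: measurable_funM => //.
  exact: measurable_funB.
Qed.

(* The disturbance is a standard Gaussian, independent of the state of the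
   channel, which is good with probability b (for b in [0, 1]). *)
Definition noise (b : R) : giry (measurableTypeR R * bool)%type R :=
  giry_prod (normal_prob 0 1 : giry _ R, bernoulli_prob b : giry _ R).

Section law.
Variable g : policy R.

Definition extend_history t (x : history R t * (measurableTypeR R * bool)) :
    history R t.+1 :=
  ([tuple of (x.1.2, g t x.1) :: x.1.1], next_state x.1.2 (g t x.1) x.2).

Lemma measurable_extend_history t : measurable_fun setT (@extend_history t).
Proof.
have mh := @measurable_fst _ _ (history R t) (measurableTypeR R * bool)%type.
have msu : measurable_fun setT
    (fun x : history R t * (measurableTypeR R * bool) => (x.1.2, g t x.1)).
  apply: measurable_fun_pair => /=.
    exact: measurableT_comp measurable_snd mh.
  exact: measurableT_comp (@measurable_action _ g t) mh.
apply: measurable_fun_pair => /=.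
  apply: measurable_cons => //.
  exact: measurableT_comp measurable_fst mh.
apply: (measurableT_comp measurable_next_state
  (g := fun x : history R t * (measurableTypeR R * bool) =>
          ((x.1.2, g t x.1), x.2))).
exact: measurable_fun_pair.
Qed.

(* The law of the history at time t.+1 given that the history at time t is
   h: the noise is drawn independently of the past. *)
Definition history_step t (h : history R t) : giry (history R t.+1) R :=
  giry_map (@measurable_extend_history t)
    (giry_prod (giry_ret h, noise h.2.2)).

Lemma measurable_history_step t : measurable_fun setT (@history_step t).
Proof.
apply: (measurableT_comp (measurable_giry_map _)).
apply: (measurableT_comp measurable_giry_prod).
apply: measurable_fun_pair => /=; first exact: measurable_giry_ret.
apply: (measurableT_comp measurable_giry_prod).
apply: measurable_fun_pair => //=.
apply: measurable_giry_codensity => // B mB.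
apply: (measurableT_comp (measurable_bernoulli_prob2 mB)).
exact: measurableT_comp measurable_snd measurable_snd.
Qed.

(* The law of the history at time t under the policy g from the state s. *)
Fixpoint history_law (s : R * R) (t : nat) : giry (history R t) R :=
  if t is t'.+1 then giry_bind (history_law s t') (@measurable_history_step t')
  else giry_ret ([tuple], s).

Definition stage_cost t (h : history R t) : R :=
  h.2.1 ^+ 2 + lambda * (g t h)%:R.

(* All the costs are nonnegative (for 0 <= lambda and 0 <= beta): the
   expectation of the infinite sum is the sum of the expectations, which only
   involve the laws of the finite histories. *)
Definition discounted_cost (s : R * R) : \bar R :=
  (\sum_(0 <= t <oo)
     (beta ^+ t)%:E * \int[history_law s t]_h (stage_cost h)%:E)%E.

End law.

Definition value (e b : R) : \bar R :=
  ereal_inf [set discounted_cost g (e, b) | g in setT].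

Definition phi (z : R) : R := expR (- (z ^+ 2 / 2)) / Num.sqrt (2 * pi).

Definition Qvalue (e b : R) (u : bool) : \bar R :=
  let no_reset b' := (\int[lebesgue_measure]_(y in `[0%R, +oo[)
    ((phi (y - a * e) + phi (y + a * e))%:E * value y b'))%E in
  let reset := (\int[lebesgue_measure]_(y in `[0%R, +oo[)
    ((2 * phi y)%:E * value y p11))%E in
  if u then
    ((e ^+ 2 + lambda)%:E + (beta * b)%:E * reset
       + (beta * (1 - b))%:E * no_reset p01)%E
  else
    ((e ^+ 2)%:E + beta%:E * no_reset (belief_update b))%E.

Definition optimal_action (e b : R) (u : bool) : Prop :=
  forall v : bool, (Qvalue e b u <= Qvalue e b v)%E.

End folded_pomdp.

(* Main.v *)
Require Import Defs.
From mathcomp Require Import all_boot all_order all_algebra.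
From mathcomp Require Import all_classical all_reals all_analysis.
From mathcomp Require Import measurable_realfun giry.
From mathcomp Require Import ring lra.

(* All costs are nonnegative and there are two actions, so the value function
   is the limit of value iteration from 0: no policy does better than the n-th
   iterate over n steps, and the policy that is greedy for the limit attains it.
   The properties are then proved for the iterates.
   - Monotonicity in the error: for m >= m' >= 0, |m + w| dominates |m' + w|
     stochastically (reflection about the midpoint of m and m').
   - The two action values at a fixed error, as functions of the belief b, are
     q1, which is affine, and q0 b = e^2 + beta W (T b), T affine. Property (C)
     for the continuation gives q0 y - q1 y <= (y / x) (q0 x - q1 x) for
     0 <= y <= x, whence the threshold.
   - Property (C) for min q0 q1 is preserved by a case analysis on the optimal
     actions at x and y: if they agree, it follows from affinity of q1 or from
     (C) for the continuation; transmitting only at the smaller belief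
     contradicts the threshold; transmitting only at the larger one requires
     the concavity of the value in the belief, also carried by the induction.
   The assumption a^2 (1 - p01) < 1 makes all these quantities finite. *)

Import Order.TTheory GRing.Theory Num.Theory.
Import numFieldNormedType.Exports.

Local Open Scope classical_set_scope.
Local Open Scope ring_scope.

(** * Value iteration *)

Section bellman.
Context {R : realType}.
Variables (a lambda beta p01 p11 : R).
Hypotheses (lambda_ge0 : 0 <= lambda) (beta_ge0 : 0 <= beta).
Implicit Types (v : R * R -> \bar R) (s : R * R).

Local Notation next := (next_state a p01 p11).
Local Notation hlaw := (history_law a p01 p11).

Definition expect_next v s (u : bool) : \bar R :=
  giry_int (noise s.2) (fun n => v (next s u n)).

Definition action_value v s (u : bool) : \bar R :=
  ((s.1 ^+ 2 + lambda * u%:R)%:E + beta%:E * expect_next v s u)%E.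

Definition bellman v s : \bar R :=
  Order.min (action_value v s false) (action_value v s true).

Lemma measurable_noise : measurable_fun setT (@noise R).
Proof.
apply: (measurableT_comp measurable_giry_prod).
apply: measurable_fun_pair => //=.
apply: measurable_giry_codensity => // B mB.
exact: measurable_bernoulli_prob2.
Qed.

Lemma measurable_next_state_noise (u : bool) :
  measurable_fun setT
    (fun x : (R * R) * (measurableTypeR R * bool) => next x.1 u x.2).
Proof.
apply: (measurableT_comp (measurable_next_state a p01 p11)
  (g := fun x : (R * R) * (measurableTypeR R * bool) => ((x.1, u), x.2))).
by apply: measurable_fun_pair => //=; apply: measurable_fun_pair.
Qed.

Lemma measurable_next_state_at s (u : bool) :
  measurable_fun setT (fun n : measurableTypeR R * bool => next s u n).
Proof.
apply: (measurableT_comp (measurable_next_state_noise u)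
  (g := fun n : measurableTypeR R * bool => (s, n))).
exact: pair1_measurable.
Qed.

(** The state enters both the law and the integrand. Integrating one fixed function against the
    product of the Dirac mass at [s] with the noise moves all the dependence into the measure, which
    is measurable in [s]. *)
Lemma measurable_expect_next v (u : bool) :
  measurable_fun setT v -> (forall s, 0 <= v s)%E ->
  measurable_fun setT (expect_next v ^~ u).
Proof.
move=> mv v0.
have mvn : measurable_fun setT
    (fun x : (R * R) * (measurableTypeR R * bool) => v (next x.1 u x.2)).
  exact: measurableT_comp mv (measurable_next_state_noise u).
apply: (eq_measurable_fun (fun s =>
    giry_int (giry_prod (giry_ret s, noise s.2))
      (fun x : (R * R) * (measurableTypeR R * bool) => v (next x.1 u x.2)))).
  move=> s _; rewrite giry_int_prod2//=; apply: eq_integral => n _ /=.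
  rewrite giry_int_ret//.
  exact: (measurableT_comp mvn (pair2_measurable _)).
apply: (measurableT_comp (measurable_giry_int mvn _)) => //.
apply: (measurableT_comp measurable_giry_prod).
apply: measurable_fun_pair => /=; first exact: measurable_giry_ret.
exact: (measurableT_comp measurable_noise measurable_snd).
Qed.

Lemma expect_next_ge0 v s u : (forall s, 0 <= v s)%E ->
  (0 <= expect_next v s u)%E.
Proof. by move=> v0; exact: integral_ge0. Qed.

Lemma measurable_expect_integrand v s u : measurable_fun setT v ->
  measurable_fun setT (fun n : measurableTypeR R * bool => v (next s u n)).
Proof. by move=> mv; exact: (measurableT_comp mv (measurable_next_state_at s u)). Qed.

Lemma le_expect_next v1 v2 s u :
  measurable_fun setT v1 -> measurable_fun setT v2 ->
  (forall s, 0 <= v1 s)%E -> (forall s, v1 s <= v2 s)%E ->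
  (expect_next v1 s u <= expect_next v2 s u)%E.
Proof.
move=> m1 m2 v0 v12; apply: ge0_le_integral => //.
- exact: measurable_expect_integrand.
- exact: measurable_expect_integrand.
Qed.

Lemma measurable_action_value v u :
  measurable_fun setT v -> (forall s, 0 <= v s)%E ->
  measurable_fun setT (action_value v ^~ u).
Proof.
move=> mv v0; apply: emeasurable_funD.
  apply/measurable_EFinP; apply: measurable_funD => //.
  by apply: measurable_funX; exact: measurable_fst.
by apply: measurable_funeM; exact: measurable_expect_next.
Qed.

Lemma action_value_ge0 v s u : (forall s, 0 <= v s)%E ->
  (0 <= action_value v s u)%E.
Proof.
move=> v0; apply: adde_ge0.
  by rewrite lee_fin addr_ge0 ?sqr_ge0// mulr_ge0.
by apply: mule_ge0; [rewrite lee_fin|exact: expect_next_ge0].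
Qed.

Lemma le_action_value v1 v2 s u :
  measurable_fun setT v1 -> measurable_fun setT v2 ->
  (forall s, 0 <= v1 s)%E -> (forall s, v1 s <= v2 s)%E ->
  (action_value v1 s u <= action_value v2 s u)%E.
Proof.
move=> m1 m2 v0 v12; apply: leeD => //; apply: lee_wpmul2l => //.
exact: le_expect_next.
Qed.

Definition value_iter (n : nat) : R * R -> \bar R := iter n bellman (cst 0%E).

Lemma value_iterS n : value_iter n.+1 = bellman (value_iter n).
Proof. by []. Qed.

Lemma value_iter_ge0 n s : (0 <= value_iter n s)%E.
Proof.
elim: n s => [|n IH] s //; rewrite value_iterS.
by rewrite le_min; apply/andP; split; exact: action_value_ge0.
Qed.

Lemma measurable_value_iter n : measurable_fun setT (value_iter n).
Proof.
elim: n => [|n IH]; first exact: measurable_cst.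
rewrite value_iterS.
by apply: measurable_mine; apply: measurable_action_value => //;
  exact: value_iter_ge0.
Qed.


Lemma value_iter_leS n s : (value_iter n s <= value_iter n.+1 s)%E.
Proof.
elim: n s => [|n IH] s; first exact: (value_iter_ge0 1); rewrite !value_iterS.
by apply: le_min2; apply: le_action_value => //;
  [exact: measurable_value_iter|exact: (measurable_value_iter n.+1)
  |exact: value_iter_ge0|exact: measurable_value_iter
  |exact: (measurable_value_iter n.+1)|exact: value_iter_ge0].
Qed.

Lemma value_iter_nd s : nondecreasing_seq (value_iter ^~ s).
Proof. by apply/nondecreasing_seqP => n; exact: value_iter_leS. Qed.

Definition value_lim s : \bar R := ereal_sup (range (value_iter ^~ s)).

Lemma cvg_value_iter s : value_iter ^~ s @ \oo --> value_lim s.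
Proof. exact/ereal_nondecreasing_cvgn/value_iter_nd. Qed.

Lemma value_iter_le_lim n s : (value_iter n s <= value_lim s)%E.
Proof. by apply: ereal_sup_ubound; exists n. Qed.

Lemma value_lim_le s x : (forall n, value_iter n s <= x)%E -> (value_lim s <= x)%E.
Proof. by move=> h; apply: ge_ereal_sup => _ [n _ <-]. Qed.

Lemma value_lim_ge0 s : (0 <= value_lim s)%E.
Proof. exact: le_trans (value_iter_ge0 0 s) (value_iter_le_lim 0 s). Qed.

Lemma measurable_value_lim : measurable_fun setT value_lim.
Proof.
by apply: (emeasurable_fun_cvg value_iter) => [n|s _];
  [exact: measurable_value_iter|exact: cvg_value_iter].
Qed.

(** By monotone convergence; nonnegativity rules out an undefined extended sum. *)
Lemma cvg_action_value s u :
  action_value (value_iter n) s u @[n --> \oo] --> action_value value_lim s u.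
Proof.
apply: cvgeD; [|exact: cvg_cst|apply: cvgeZl => //].
  apply: ge0_adde_def; rewrite inE ?lee_fin.
    by rewrite addr_ge0 ?sqr_ge0// mulr_ge0.
  by apply: mule_ge0 => //; apply: expect_next_ge0; exact: value_lim_ge0.
rewrite [X in _ --> X](_ : _ =
    giry_int (noise s.2) (fun x => limn (fun k => value_iter k (next s u x)))).
  apply: cvg_monotone_convergence => //.
  - by move=> n; apply: measurable_expect_integrand; exact: measurable_value_iter.
  - by move=> n x _; exact: value_iter_ge0.
  - by move=> x _; exact: value_iter_nd.
by apply: eq_integral => x _; apply/esym/cvg_lim => //; exact: cvg_value_iter.
Qed.

Lemma lt_action_value_near s u x : (x < action_value value_lim s u)%E ->
  \forall n \near \oo, (x < action_value (value_iter n) s u)%E.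
Proof.
move=> xlt.
have nb : nbhs (action_value value_lim s u) [set y | (x < y)%E].
  by apply: open_nbhs_nbhs; split => //; exact: open_ereal_gt_ereal.
exact: (cvg_action_value s u _ nb).
Qed.

(** One inequality is monotonicity. If the other failed, both action values of the limit would
    exceed [value_lim s]; with two actions, both do so already at a common iterate N, and iterate N
    + 1 would exceed the limit. *)
Lemma value_lim_bellman s : value_lim s = bellman value_lim s.
Proof.
apply/eqP; rewrite eq_le; apply/andP; split.
  apply: value_lim_le => n; apply: le_trans (value_iter_leS n s) _.
  rewrite value_iterS; apply: le_min2; apply: le_action_value;
    (exact: measurable_value_iter || exact: measurable_value_lim ||
     exact: value_iter_ge0 || (move=> ?; exact: value_iter_le_lim)).
rewrite leNgt; apply/negP; rewrite lt_min => /andP[h0 h1].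
have [N _ hN] := filterI (lt_action_value_near _ _ _ h0)
  (lt_action_value_near _ _ _ h1).
have [] := hN N (leqnn N) => lt0 lt1.
have : (value_lim s < value_iter N.+1 s)%E by rewrite value_iterS lt_min lt0.
by rewrite ltNge value_iter_le_lim.
Qed.

End bellman.

(** * The limit of value iteration is the value function *)

Section optimality.
Context {R : realType}.
Variables (a lambda beta p01 p11 : R).
Hypotheses (lambda_ge0 : 0 <= lambda) (beta_ge0 : 0 <= beta).
Implicit Types (v : R * R -> \bar R) (s : R * R) (g : policy R).

Local Notation hlaw := (history_law a p01 p11).
Local Notation expect := (expect_next a p01 p11).
Local Notation act := (action_value a lambda beta p01 p11).
Local Notation viter := (value_iter a lambda beta p01 p11).
Local Notation vlim := (value_lim a lambda beta p01 p11).

Lemma measurable_current_state t v : measurable_fun setT v ->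
  measurable_fun setT (fun h : history R t => v h.2).
Proof. by move=> mv; exact: measurableT_comp mv measurable_snd. Qed.

(** Given the history, the next state depends only on the current state, the chosen action and fresh
    noise, even when the action itself depends on the whole past. *)
Lemma integral_history_lawS g s t v :
  measurable_fun setT v -> (forall s, 0 <= v s)%E ->
  (\int[hlaw g s t.+1]_h v h.2 =
   \int[hlaw g s t]_h expect v h.2 (g t h))%E.
Proof.
move=> mv v0.
have mv2 : measurable_fun setT (fun h : history R t.+1 => v h.2).
  exact: measurableT_comp mv measurable_snd.
rewrite -[LHS]/(giry_int _ _) [hlaw _ _ _]/=.
rewrite giry_int_bind//; apply: eq_integral => h _.
rewrite /history_step giry_int_map//.
have mvx := measurableT_comp mv2 (@measurable_extend_history R a p01 p11 g t).
rewrite giry_int_prod2//; last by move=> x; exact: v0.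
apply: eq_integral => n _; rewrite giry_int_ret//.
exact: (measurableT_comp mvx (pair2_measurable _)).
Qed.

Lemma measurable_stage_cost g t :
  measurable_fun setT (@stage_cost R lambda g t).
Proof.
apply: measurable_funD.
  apply: measurable_funX; exact: measurableT_comp measurable_fst measurable_snd.
apply: measurable_funM => //.
rewrite (_ : (fun _ => _) = fun h => if g t h then 1 else 0 : R); last first.
  by apply/funext => h; case: (g t h).
by apply: measurable_fun_ifT => //; exact: measurable_action.
Qed.

Lemma stage_cost_ge0 g t h : 0 <= @stage_cost R lambda g t h.
Proof. by rewrite addr_ge0 ?sqr_ge0// mulr_ge0. Qed.

Lemma integral_history_law0 g s v : measurable_fun setT v ->
  (\int[hlaw g s 0]_h v h.2)%E = v s.
Proof.
move=> mv; rewrite -[LHS]/(giry_int _ _) giry_int_ret//.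
exact: measurableT_comp mv measurable_snd.
Qed.

Lemma measurable_action_value_history g t v :
  measurable_fun setT v -> (forall s, 0 <= v s)%E ->
  measurable_fun setT (fun h : history R t => act v h.2 (g t h)).
Proof.
move=> mv v0.
rewrite (_ : (fun _ => _) =
    fun h => if g t h then act v h.2 true else act v h.2 false).
  apply: measurable_fun_ifT; first exact: measurable_action.
    apply: (measurable_current_state t (act v ^~ true)).
    exact: measurable_action_value.
  apply: (measurable_current_state t (act v ^~ false)).
  exact: measurable_action_value.
by apply/funext => h; case: (g t h).
Qed.

Lemma measurable_expect_next_history g t v :
  measurable_fun setT v -> (forall s, 0 <= v s)%E ->
  measurable_fun setT (fun h : history R t => expect v h.2 (g t h)).
Proof.
move=> mv v0.
rewrite (_ : (fun _ => _) =
    fun h => if g t h then expect v h.2 true else expect v h.2 false).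
  apply: measurable_fun_ifT; first exact: measurable_action.
    apply: (measurable_current_state t (expect v ^~ true)).
    exact: measurable_expect_next.
  apply: (measurable_current_state t (expect v ^~ false)).
  exact: measurable_expect_next.
by apply/funext => h; case: (g t h).
Qed.

Lemma integral_action_value g s t v :
  measurable_fun setT v -> (forall s, 0 <= v s)%E ->
  (\int[hlaw g s t]_h act v h.2 (g t h) =
   \int[hlaw g s t]_h (stage_cost lambda g h)%:E
     + beta%:E * \int[hlaw g s t.+1]_h v h.2)%E.
Proof.
move=> mv v0.
have e0 h : (0 <= expect v h.2 (g t h))%E by exact: expect_next_ge0.
have me := measurable_expect_next_history g t v mv v0.
have c0 h : (0 <= (stage_cost lambda g (t := t) h)%:E)%E.
  rewrite lee_fin. exact: stage_cost_ge0.
have mc : measurable_fun setT (fun h => (stage_cost lambda g (t := t) h)%:E).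
  by apply/measurable_EFinP; exact: measurable_stage_cost.
rewrite (integral_history_lawS g s t v mv v0) -ge0_integralZl// -ge0_integralD//.
  by move=> h _; rewrite mule_ge0.
exact: measurable_funeM.
Qed.

Definition cost_upto g s (k : nat) : \bar R :=
  (\sum_(0 <= t < k)
     (beta ^+ t)%:E * \int[hlaw g s t]_h (stage_cost lambda g h)%:E)%E.

(** At each step the Bellman minimum is at most the action value of the action that [g] takes.
    Lengthening the prefix by one step uses the induction hypothesis at [n.+1], so [n] stays
    general. *)
Lemma value_iter_le_cost_upto g s k n :
  (viter (n + k) s <= cost_upto g s k
     + (beta ^+ k)%:E * \int[hlaw g s k]_h viter n h.2)%E.
Proof.
elim: k n => [|k IH] n.
  rewrite /cost_upto big_geq// add0e expr0 mul1e addn0 integral_history_law0//.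
  exact: measurable_value_iter.
rewrite addnS -addSn; apply: le_trans (IH n.+1) _.
rewrite /cost_upto big_nat_recr//= -addeA leeD2l//.
rewrite exprSr EFinM -muleA -ge0_muleDr; last 2 first.
- by apply: integral_ge0 => h _; rewrite lee_fin; exact: stage_cost_ge0.
- by rewrite mule_ge0//; apply: integral_ge0 => h _; exact: value_iter_ge0.
apply: lee_wpmul2l; first by rewrite lee_fin exprn_ge0.
rewrite -integral_action_value; last 2 first.
- exact: measurable_value_iter.
- exact: value_iter_ge0.
apply: ge0_le_integral.
- by [].
- by move=> h _; exact: (value_iter_ge0 _ _ _ _ _ lambda_ge0 beta_ge0 n.+1).
- apply: (measurable_current_state k (viter n.+1)).
  exact: measurable_value_iter.
- apply: measurable_action_value_history; first exact: measurable_value_iter.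
  exact: value_iter_ge0.
- move=> h _; rewrite /bellman.
  by case: (g k h); rewrite ge_min lexx ?orbT.
Qed.

Lemma discounted_cost_term_ge0 g s t :
  (0 <= (beta ^+ t)%:E * \int[hlaw g s t]_h (stage_cost lambda g h)%:E)%E.
Proof.
apply: mule_ge0; first by rewrite lee_fin exprn_ge0.
by apply: integral_ge0 => h _; rewrite lee_fin; exact: stage_cost_ge0.
Qed.

Lemma value_lim_le_discounted_cost g s :
  (vlim s <= discounted_cost a lambda beta p01 p11 g s)%E.
Proof.
apply: value_lim_le => n.
(* The iteration starts from 0, so the remainder after n steps vanishes. *)
have := value_iter_le_cost_upto g s n 0; rewrite add0n => /le_trans; apply.
rewrite integral0 mule0 adde0.
by apply: nneseries_lim_ge => t _ _; exact: discounted_cost_term_ge0.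
Qed.

Definition greedy_action t (h : history R t) : bool :=
  (act vlim h.2 true <= act vlim h.2 false)%E.

Lemma measurable_greedy_action t : measurable_fun setT (@greedy_action t).
Proof.
apply: measurable_fun_lee.
  apply: (measurable_current_state t (act vlim ^~ true)).
  by apply: measurable_action_value; [exact: measurable_value_lim|exact: value_lim_ge0].
apply: (measurable_current_state t (act vlim ^~ false)).
by apply: measurable_action_value; [exact: measurable_value_lim|exact: value_lim_ge0].
Qed.

Definition greedy_policy : policy R := Policy measurable_greedy_action.

(** Here the inequality of [value_iter_le_cost_upto] becomes an equality: [vlim] is a fixed point of
    [bellman] and the greedy action attains its minimum. *)
Lemma cost_upto_greedy s k :
  (cost_upto greedy_policy s k
     + (beta ^+ k)%:E * \int[hlaw greedy_policy s k]_h vlim h.2 = vlim s)%E.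
Proof.
elim: k => [|k IH].
  rewrite /cost_upto big_geq// add0e expr0 mul1e integral_history_law0//.
  exact: measurable_value_lim.
rewrite -[RHS]IH /cost_upto big_nat_recr//= -addeA; congr (_ + _)%E.
rewrite exprSr EFinM -muleA -ge0_muleDr; last 2 first.
- by apply: integral_ge0 => h _; rewrite lee_fin; exact: stage_cost_ge0.
- by rewrite mule_ge0//; apply: integral_ge0 => h _; exact: value_lim_ge0.
congr (_ * _)%E; rewrite -integral_action_value; last 2 first.
- exact: measurable_value_lim.
- exact: value_lim_ge0.
apply: eq_integral => h _; rewrite [RHS]value_lim_bellman// /bellman /=.
rewrite /greedy_action; have [h10|h01] := leP (act vlim h.2 true) _.
  by [].
by [].
Qed.

(** Dropping the nonnegative remainder in [cost_upto_greedy] bounds every partial cost by the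
    limit. *)
Lemma discounted_cost_greedy_le s :
  (discounted_cost a lambda beta p01 p11 greedy_policy s <= vlim s)%E.
Proof.
apply: lime_le.
  by apply: is_cvg_nneseries => t _ _; exact: discounted_cost_term_ge0.
apply: nearW => k; rewrite -[leRHS](cost_upto_greedy s k).
apply: leeDl; apply: mule_ge0; first by rewrite lee_fin exprn_ge0.
by apply: integral_ge0 => h _; exact: value_lim_ge0.
Qed.

Lemma valueE e b : value a lambda beta p01 p11 e b = vlim (e, b).
Proof.
apply/eqP; rewrite eq_le; apply/andP; split.
  apply: le_trans (discounted_cost_greedy_le (e, b)).
  by apply: ereal_inf_lbound; exists greedy_policy.
by apply: le_ereal_inf_tmp => _ [g _ <-]; exact: value_lim_le_discounted_cost.
Qed.

End optimality.

(** * Expectations under a folded Gaussian *)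

Section gauss.
Context {R : realType}.
Implicit Types (f g F : R -> \bar R) (m c : R).
Local Notation mu := (@lebesgue_measure R).
Local Notation N01 := (normal_prob (0 : R) 1).

(** By uniqueness of the measure that gives half-open intervals their length. *)
Lemma lebesgue_measure_shift m (A : set R) : measurable A ->
  pushforward mu (fun x : R => (m + x : measurableTypeR R)) A = mu A.
Proof.
move=> mA; apply/esym/lebesgue_measure_unique => //=.
  exact: measurable_funD.
move=> mf _ [[x y]] _ <-.
rewrite /pushforward.
rewrite (_ : _ @^-1` _ = `]x - m, y - m]%classic); last first.
  by apply/seteqP; split => z /=; rewrite !in_itv /= lerBrDl ltrBlDl.
rewrite !lebesgue_measure_itv/= !lte_fin ltrD2r.
by case: ifP => // _; rewrite -!EFinD; congr (_%:E); ring.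
Qed.

Lemma ge0_integral_shift m F : measurable_fun setT F -> (forall x, 0 <= F x)%E ->
  (\int[mu]_x F x = \int[mu]_x F (m + x)%R)%E.
Proof.
move=> mF F0.
pose sh := +%R m : measurableTypeR R -> measurableTypeR R.
rewrite -[in RHS](preimage_setT sh) -(ge0_integral_pushforward (phi := sh))//=.
  apply: eq_measure_integral => [|? A mA _]; first exact: measurable_funD.
  exact/esym/lebesgue_measure_shift.
exact: measurable_funD.
Qed.

(** Translate [c] to 0, then fold the negative half-line onto the nonnegative one. *)
Lemma ge0_integral_reflect c F : measurable_fun setT F -> (forall x, 0 <= F x)%E ->
  (\int[mu]_x F x = \int[mu]_(r in `[0%R, +oo[) (F (c + r)%R + F (c - r)%R))%E.
Proof.
move=> mF F0.
have m1 : measurable_fun setT (fun r : R => F (c + r)).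
  by apply: (measurableT_comp mF); exact: measurable_funD.
have m2 : measurable_fun setT (fun r : R => F (c - r)).
  by apply: (measurableT_comp mF); exact: measurable_funB.
rewrite ge0_integralD//; last 2 first.
- exact: measurable_funTS.
- exact: measurable_funTS.
rewrite (ge0_integration_by_substitution0 m2)//.
under [X in (_ + X)%E]eq_integral do rewrite opprK.
(* Removing the null point 0 makes the two half-lines disjoint. *)
rewrite addeC -integral_itv_obnd_cbnd; last exact: measurable_funTS.
rewrite -ge0_integral_setU//=; last 2 first.
- exact: measurable_funTS.
- rewrite disj_set2E; apply/eqP; rewrite -subset0 => x []/=.
  by rewrite !in_itv/= andbT leNgt => /negP.
by rewrite (ge0_integral_shift c)// -setCitvr setvU.
Qed.

Lemma phi_normal_pdf : @phi R = normal_pdf 0 1.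
Proof.
rewrite normal_pdfE ?oner_eq0//; apply/funext => x.
rewrite /phi /normal_peak /normal_fun mulrC expr1n mul1r subr0 mulr_natl.
by rewrite mulNr.
Qed.

Lemma phi_gt0 x : 0 < @phi R x.
Proof. by rewrite divr_gt0 ?expR_gt0// sqrtr_gt0 mulr_gt0 ?pi_gt0. Qed.

Lemma phiN x : @phi R (- x) = phi x.
Proof. by rewrite /phi sqrrN. Qed.

Lemma le_phi (x y : R) : `|x| <= `|y| -> phi y <= phi x.
Proof.
move=> xy; rewrite ler_pM2r ?invr_gt0 ?sqrtr_gt0 ?mulr_gt0 ?pi_gt0//.
rewrite ler_expR lerN2 ler_pM2r ?invr_gt0//.
by rewrite -(real_normK (num_real x)) -(real_normK (num_real y)) lerXn2r ?nnegrE.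
Qed.

Lemma measurable_phi : measurable_fun setT (@phi R).
Proof. by rewrite phi_normal_pdf; exact: measurable_normal_pdf. Qed.

(** The change of variables is stated for the Radon-Nikodym derivative, which equals [phi] almost
    everywhere because both have the same integral on every measurable set. *)
Lemma integral_normal_prob f : measurable_fun setT f -> (forall x, 0 <= f x)%E ->
  (\int[N01]_x f x = \int[mu]_x (f x * (phi x)%:E))%E.
Proof.
move=> mf f0.
have dom := normal_prob_dominates (0 : R) 1.
rewrite -(Radon_Nikodym_SigmaFinite.change_of_variables dom)//.
apply: ae_eq_integral => //.
- apply: emeasurable_funM => //.
  exact: measurable_int (Radon_Nikodym_SigmaFinite.f_integrable dom).
- apply: emeasurable_funM => //; apply/measurable_EFinP; exact: measurable_phi.
apply: ae_eqe_mul2l; apply: integral_ae_eq => //.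
- exact: Radon_Nikodym_SigmaFinite.f_integrable.
- apply/measurable_EFinP; exact: measurable_phi.
move=> A _ mA; rewrite -Radon_Nikodym_SigmaFinite.f_integral//.
by rewrite phi_normal_pdf.
Qed.

Definition folded_expect f m : \bar R := (\int[N01]_w f `|m + w|%R)%E.

Lemma measurable_folded f m : measurable_fun setT f ->
  measurable_fun setT (fun w : R => f `|m + w|%R).
Proof.
move=> mf; apply: (measurableT_comp mf); apply: measurableT_comp => //.
exact: measurable_funD.
Qed.

Lemma folded_expect_ge0 f m : (forall x, 0 <= f x)%E -> (0 <= folded_expect f m)%E.
Proof. by move=> f0; exact: integral_ge0. Qed.

Lemma measurable_folded_density f m (k : R -> R) : measurable_fun setT f ->
  measurable_fun setT k ->
  measurable_fun setT (fun x : R => f `|k x|%R * (phi (k x - m)%R)%:E)%E.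
Proof.
move=> mf mk; apply: emeasurable_funM.
  by apply: (measurableT_comp mf); exact: measurableT_comp.
apply/measurable_EFinP; apply: (measurableT_comp measurable_phi).
exact: measurable_funB.
Qed.

Lemma folded_density_ge0 f m (y x : R) : (forall x, 0 <= f x)%E ->
  (0 <= f y * (phi (x - m))%:E)%E.
Proof. by move=> f0; rewrite mule_ge0// lee_fin ltW// phi_gt0. Qed.

Lemma folded_expectE_lebesgue f m :
  measurable_fun setT f -> (forall x, 0 <= f x)%E ->
  (folded_expect f m = \int[mu]_x (f `|x|%R * (phi (x - m))%:E))%E.
Proof.
move=> mf f0.
rewrite /folded_expect (integral_normal_prob _ (measurable_folded f m mf) (fun x => f0 _)).
rewrite [RHS](ge0_integral_shift m _
  (measurable_folded_density f m id mf (@measurable_id _ _ _))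
  (fun x => folded_density_ge0 f m _ x f0)).
by apply: eq_integral => x _; congr (_ * (phi _)%:E)%E; ring.
Qed.

Lemma folded_expect_reflect c f m :
  measurable_fun setT f -> (forall x, 0 <= f x)%E ->
  (folded_expect f m = \int[mu]_(r in `[0%R, +oo[)
    (f `|c + r|%R * (phi (c + r - m))%:E + f `|c - r|%R * (phi (c - r - m))%:E))%E.
Proof.
move=> mf f0; rewrite (folded_expectE_lebesgue f m mf f0).
exact: (ge0_integral_reflect c _
  (measurable_folded_density f m id mf (@measurable_id _ _ _))
  (fun x => folded_density_ge0 f m _ x f0)).
Qed.

(** Reflection about 0 gives the half-line integral that appears in [Qvalue]. *)
Lemma folded_expectE f m :
  measurable_fun setT f -> (forall x, 0 <= f x)%E ->
  (folded_expect f m =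
   \int[mu]_(y in `[0%R, +oo[) ((phi (y - m) + phi (y + m))%:E * f y))%E.
Proof.
move=> mf f0; rewrite (folded_expect_reflect 0 f m mf f0); apply: eq_integral => r.
rewrite inE /= in_itv /= andbT => r0.
rewrite add0r sub0r normrN ger0_norm// -opprD phiN.
rewrite -ge0_muleDr ?lee_fin ?(ltW (phi_gt0 _))//.
by rewrite -EFinD muleC.
Qed.

Lemma folded_expectN f m :
  measurable_fun setT f -> (forall x, 0 <= f x)%E ->
  folded_expect f (- m) = folded_expect f m.
Proof.
move=> mf f0; rewrite (folded_expectE f (- m) mf f0) (folded_expectE f m mf f0).
apply: eq_integral => r _.
by rewrite opprK addrC.
Qed.

(* Reflecting about c = (m + m') / 2 pairs the points c + r and c - r, r >= 0:
   the first one has the larger modulus, and moving the mean from m' to m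
   transfers mass from the second one to the first one. *)
Lemma le_folded_expect_shift f m m' :
  measurable_fun setT f -> (forall x, 0 <= f x)%E ->
  (forall x y, 0 <= x -> x <= y -> (f x <= f y)%E) ->
  `|m'| <= m -> (folded_expect f m' <= folded_expect f m)%E.
Proof.
move=> mf f0 ndf; rewrite ler_norml => /andP[m'm mm'].
set c := (m + m') / 2; set d := (m - m') / 2.
have c0 : 0 <= c by rewrite /c; lra.
have d0 : 0 <= d by rewrite /d; lra.
rewrite (folded_expect_reflect c f m mf f0) (folded_expect_reflect c f m' mf f0).
have mcr : measurable_fun setT (fun r : R => c + r) by exact: measurable_funD.
have mcl : measurable_fun setT (fun r : R => c - r) by exact: measurable_funB.
have mI (p : R) : measurable_fun (`[0%R, +oo[%classic : set R)
    (fun r => f `|c + r|%R * (phi (c + r - p)%R)%:E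
            + f `|c - r|%R * (phi (c - r - p)%R)%:E)%E.
  apply: measurable_funTS; apply: emeasurable_funD.
    exact: (measurable_folded_density f p _ mf mcr).
  exact: (measurable_folded_density f p _ mf mcl).
apply: ge0_le_integral.
- by [].
- by move=> r _; apply: adde_ge0; rewrite mule_ge0// lee_fin ltW// phi_gt0.
- exact: mI.
- exact: mI.
move=> r; rewrite /= in_itv /= andbT => r0.
have -> : c + r - m = r - d by rewrite /c /d; field.
have -> : c + r - m' = r + d by rewrite /c /d; field.
have -> : c - r - m = - (r + d) by rewrite /c /d; field.
have -> : c - r - m' = - (r - d) by rewrite /c /d; field.
rewrite !phiN.
have ph : phi (r + d) <= phi (r - d).
  apply: le_phi; rewrite (ger0_norm (addr_ge0 r0 d0)) ler_norml.
  by apply/andP; split; lra.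
have fcr : (f `|c - r|%R <= f `|c + r|%R)%E.
  apply: ndf => //.
  rewrite (ger0_norm (addr_ge0 c0 r0)) ler_norml.
  by apply/andP; split; lra.
(* Both sides contain [phi (r + d)] times the sum of the two values of [f]; what remains is [D]
   times the value at |c - r| on the left and at |c + r| on the right. *)
rewrite -(subrK (phi (r + d)) (phi (r - d))); set D := phi (r - d) - _.
have D0 : 0 <= D by rewrite subr_ge0.
have p0 := ltW (phi_gt0 (r + d)).
rewrite EFinD !ge0_muleDr ?lee_fin//.
rewrite [in leRHS](addeC (_ * D%:E))%E -addeA leeD2l// leeD2r//.
exact: lee_wpmul2r.
Qed.

(** The mean a e may be negative; Gaussian symmetry reduces to [m] nonnegative. *)
Lemma le_folded_expect f m m' :
  measurable_fun setT f -> (forall x, 0 <= f x)%E ->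
  (forall x y, 0 <= x -> x <= y -> (f x <= f y)%E) ->
  `|m'| <= `|m| -> (folded_expect f m' <= folded_expect f m)%E.
Proof.
move=> mf f0 ndf; have [m0|m0] := ger0P m.
  exact: le_folded_expect_shift.
by rewrite -(folded_expectN f m)//; exact: le_folded_expect_shift.
Qed.

Lemma le_folded_expect_fun f1 f2 m :
  measurable_fun setT f1 -> measurable_fun setT f2 ->
  (forall x, 0 <= f1 x)%E -> (forall x, 0 <= x -> (f1 x <= f2 x)%E) ->
  (folded_expect f1 m <= folded_expect f2 m)%E.
Proof.
move=> m1 m2 f0 f12; apply: ge0_le_integral => //.
- exact: measurable_folded.
- exact: measurable_folded.
- by move=> w _; exact: f12.
Qed.

Lemma integral_normal_prob_cst k : (\int[N01]_w k)%E = k.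
Proof.
rewrite integral_cst// -[RHS]mule1; congr (_ * _)%E.
exact: probability_setT.
Qed.

Lemma folded_expect_cst k m : folded_expect (cst k) m = k.
Proof. exact: integral_normal_prob_cst. Qed.

Lemma folded_expectD f1 f2 m :
  measurable_fun setT f1 -> measurable_fun setT f2 ->
  (forall x, 0 <= f1 x)%E -> (forall x, 0 <= f2 x)%E ->
  (folded_expect (f1 \+ f2) m = folded_expect f1 m + folded_expect f2 m)%E.
Proof.
move=> m1 m2 f10 f20; rewrite -ge0_integralD//; exact: measurable_folded.
Qed.

Lemma folded_expectZ (k : R) f m : 0 <= k ->
  measurable_fun setT f -> (forall x, 0 <= f x)%E ->
  (folded_expect (fun x => k%:E * f x) m = k%:E * folded_expect f m)%E.
Proof.
move=> k0 mf f0; rewrite -ge0_integralZl_EFin//; exact: measurable_folded.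
Qed.

(* The density of variance 2, up to a constant, dominates w^2 phi(w), because
   w^2 / 4 <= exp(w^2 / 4). *)
Lemma normal_second_moment_bounded :
  exists2 K : R, 0 <= K & (\int[N01]_w (w ^+ 2)%:E <= K%:E)%E.
Proof.
have s20 : Num.sqrt 2 != 0 :> R by rewrite sqrtr_eq0 -ltNge.
pose K : R := 4 * (normal_peak 1 / normal_peak (Num.sqrt 2)).
have K0 : 0 <= K by rewrite mulr_ge0// divr_ge0// normal_peak_ge0.
have mpdf : measurable_fun setT (fun x : R => (normal_pdf 0 (Num.sqrt 2) x)%:E).
  by apply/measurable_EFinP; exact: measurable_normal_pdf.
have pdf0 (x : R) : (0 <= (normal_pdf 0 (Num.sqrt 2) x)%:E)%E.
  by rewrite lee_fin normal_pdf_ge0.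
exists K => //.
rewrite integral_normal_prob//; last 2 first.
- by apply/measurable_EFinP; exact: exprn_measurable.
- by move=> x; rewrite lee_fin sqr_ge0.
rewrite -[leRHS]mule1 -(@integral_normal_pdf R 0 (Num.sqrt 2)).
rewrite -ge0_integralZl_EFin//.
apply: ge0_le_integral.
- by [].
- by move=> x _; rewrite -EFinM lee_fin mulr_ge0 ?sqr_ge0// ltW// phi_gt0.
- apply/measurable_EFinP; apply: measurable_funM; last exact: measurable_phi.
  exact: exprn_measurable.
- exact: measurable_funeM.
move=> x _; rewrite -EFinM lee_fin phi_normal_pdf !normal_pdfE//.
have -> : normal_fun 0 1 x = expR (- (x ^+ 2 / 4)) * expR (- (x ^+ 2 / 4)).
  by rewrite -expRD /normal_fun subr0 expr1n; congr expR; field.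
have -> : normal_fun 0 (Num.sqrt 2) x = expR (- (x ^+ 2 / 4)).
  by rewrite /normal_fun subr0 sqr_sqrtr//; congr expR; field.
have -> : K * (normal_peak (Num.sqrt 2) * expR (- (x ^+ 2 / 4))) =
          normal_peak 1 * (4 * expR (- (x ^+ 2 / 4))).
  by rewrite /K; field; rewrite gt_eqF// normal_peak_gt0.
rewrite mulrCA ler_wpM2l ?normal_peak_ge0// mulrA ler_wpM2r ?expR_ge0//.
rewrite expRN ler_pdivrMr ?expR_gt0//.
have := expR_ge1Dx (x ^+ 2 / 4); lra.
Qed.

(** Young's inequality for the cross term 2 m w, with defect (eps m - w)^2 / eps. A small [eps]
    keeps the coefficient of m^2 close to 1, so that the strict assumption on [a] still gives a
    contraction. *)
Lemma folded_expect_sqr_le (K eps m : R) : 0 < eps ->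
  (\int[N01]_w (w ^+ 2)%:E <= K%:E)%E ->
  (folded_expect (fun y => (y ^+ 2)%:E) m <=
   ((1 + eps) * m ^+ 2 + (1 + eps^-1) * K)%:E)%E.
Proof.
move=> eps0 hK.
have m2 : measurable_fun setT (fun w : R => (w ^+ 2)%:E).
  by apply/measurable_EFinP; exact: exprn_measurable.
have c1 : 0 <= (1 + eps) * m ^+ 2 by rewrite mulr_ge0 ?sqr_ge0 ?addr_ge0// ltW.
have c2 : 0 <= 1 + eps^-1 by rewrite addr_ge0// invr_ge0 ltW.
have mc : measurable_fun setT (fun w : R => (1 + eps^-1)%:E * (w ^+ 2)%:E)%E.
  exact: measurable_funeM.
apply: (@le_trans _ _ (\int[N01]_w (((1 + eps) * m ^+ 2)%:E
    + (1 + eps^-1)%:E * (w ^+ 2)%:E))%E).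
  apply: ge0_le_integral.
  - by [].
  - by move=> w _; rewrite lee_fin sqr_ge0.
  - exact: (measurable_folded (fun y : R => (y ^+ 2)%:E)).
  - exact: emeasurable_funD.
  move=> w _; rewrite -EFinM -EFinD lee_fin real_normK ?num_real//.
  rewrite -subr_ge0.
  have -> : (1 + eps) * m ^+ 2 + (1 + eps^-1) * w ^+ 2 - (m + w) ^+ 2 =
            (eps * m - w) ^+ 2 / eps by field; rewrite gt_eqF.
  by rewrite divr_ge0 ?sqr_ge0// ltW.
rewrite ge0_integralD//; last by move=> w _; rewrite -EFinM lee_fin mulr_ge0 ?sqr_ge0.
rewrite integral_normal_prob_cst.
rewrite ge0_integralZl_EFin//; last by move=> w _; rewrite lee_fin sqr_ge0.
by rewrite [leRHS]EFinD leeD2l// [leRHS]EFinM lee_wpmul2l.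
Qed.

End gauss.

(** * Action values as functions of the belief *)

Lemma conv_itv01 (R : realFieldType) (b x y : R) :
  0 <= b <= 1 -> 0 <= x <= 1 -> 0 <= y <= 1 -> 0 <= b * x + (1 - b) * y <= 1.
Proof.
move=> /andP[b0 b1] /andP[x0 x1] /andP[y0 y1].
have b'0 : 0 <= 1 - b by rewrite subr_ge0.
apply/andP; split; first by rewrite addr_ge0// mulr_ge0.
have : b * x <= b * 1 by rewrite ler_wpM2l.
have : (1 - b) * y <= (1 - b) * 1 by rewrite ler_wpM2l.
lra.
Qed.

(* The dependence on the belief of the two action values at a given error:
   w b stands for the expectation of the continuation value when the belief
   becomes b and the error is not reset, r0 for its expectation after a
   successful transmission. *)
Section belief_action_values.
Context {R : realType}.
Variables (lambda beta p01 p11 : R) (w : R -> R) (r0 c : R).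
Hypotheses (lambda_ge0 : 0 <= lambda) (beta_ge0 : 0 <= beta) (beta_le1 : beta <= 1).
Hypotheses (p01_itv : 0 <= p01 <= 1) (p11_itv : 0 <= p11 <= 1) (hp : p01 <= p11).
Hypothesis w_anti : forall x y, 0 <= x <= 1 -> 0 <= y <= 1 -> x <= y -> w y <= w x.
Hypothesis w_conv : forall b x y, 0 <= b <= 1 -> 0 <= x <= 1 -> 0 <= y <= 1 ->
  y <= x -> w (b * x + (1 - b) * y) <= (1 - b) * lambda + b * w x + (1 - b) * w y.
Hypothesis r0_le : r0 <= w p11.

Local Notation T := (belief_update p01 p11).
(** Here [c] stands for the squared error. *)
Let q0 b := c + beta * w (T b).
Let q1 b := c + lambda + beta * (b * r0 + (1 - b) * w p01).

Lemma belief_update_itv b : 0 <= b <= 1 -> 0 <= T b <= 1.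
Proof. by move=> ?; exact: conv_itv01. Qed.

Lemma belief_updateE b : T b = p01 + b * (p11 - p01).
Proof. rewrite /belief_update; ring. Qed.

Lemma le_belief_update x y : x <= y -> T x <= T y.
Proof. by move=> xy; rewrite !belief_updateE lerD2l ler_wpM2r// subr_ge0. Qed.

Lemma r0_le_w01 : r0 <= w p01.
Proof. by apply: le_trans r0_le _; exact: w_anti. Qed.

Lemma q0_anti x y : 0 <= x <= 1 -> 0 <= y <= 1 -> x <= y -> q0 y <= q0 x.
Proof.
move=> hx hy xy; rewrite lerD2l ler_wpM2l//.
by apply: w_anti; [exact: belief_update_itv..|exact: le_belief_update].
Qed.

Lemma q1_anti x y : x <= y -> q1 y <= q1 x.
Proof.
move=> xy; rewrite lerD2l ler_wpM2l// -subr_ge0.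
rewrite (_ : _ - _ = (y - x) * (w p01 - r0)); last by ring.
by rewrite mulr_ge0// subr_ge0// r0_le_w01.
Qed.

(** At belief 0 a transmission surely fails: both actions have the same continuation and
    transmitting costs [lambda] more. *)
Lemma q0_le_q1_at0 : q0 0 <= q1 0.
Proof.
rewrite /q0 /q1 /belief_update !mul0r !subr0 !mul1r !add0r.
by rewrite -addrA lerD2l lerDr.
Qed.

(* Ty is a convex combination of Tx and p01 = T0, with weight y / x on Tx. *)
Lemma action_gap x y : 0 <= y -> y <= x -> 0 < x -> x <= 1 ->
  q0 y - q1 y <= y / x * (q0 x - q1 x).
Proof.
move=> y0 yx x0 x1; set t := y / x.
have t0 : 0 <= t by rewrite divr_ge0// ltW.
have t1 : t <= 1 by rewrite ler_pdivrMr// mul1r.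
have yE : y = t * x by rewrite divfK// gt_eqF.
have xI : 0 <= x <= 1 by rewrite (ltW x0).
have TyE : T y = t * T x + (1 - t) * p01 by rewrite yE /belief_update; ring.
have wTy : w (T y) <= (1 - t) * lambda + t * w (T x) + (1 - t) * w p01.
  rewrite TyE; apply: w_conv; rewrite ?t0 ?t1//.
    exact: belief_update_itv.
  by rewrite belief_updateE lerDl mulr_ge0 ?subr_ge0// ltW.
have h1 := ler_wpM2l beta_ge0 wTy.
(* After discounting, [wTy] carries the term beta (1 - t) lambda, while the undiscounted cost in
   [q1] provides (1 - t) lambda; [h2] is the surplus. *)
have h2 : 0 <= (1 - beta) * (1 - t) * lambda by rewrite !mulr_ge0 ?subr_ge0.
rewrite /q0 /q1 -subr_ge0 yE.
rewrite -subr_ge0 in h1; apply: le_trans (addr_ge0 h2 h1) _.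
rewrite le_eqVlt; apply/orP; left; apply/eqP; rewrite yE; ring.
Qed.

(** A nonnegative gap at [y] passes to [x] by [action_gap], as the factor y / x is positive. *)
Lemma transmit_monotone x y : 0 < y -> y <= x -> x <= 1 ->
  q1 y <= q0 y -> q1 x <= q0 x.
Proof.
move=> y0 yx x1 hy; have x0 := lt_le_trans y0 yx.
have := action_gap _ _ (ltW y0) yx x0 x1.
move/(le_trans (_ : 0 <= q0 y - q1 y)); rewrite subr_ge0 => /(_ hy).
by rewrite pmulr_rge0 ?divr_gt0// subr_ge0.
Qed.

Lemma min_q_conv b x y :
  (forall b x y, 0 <= b <= 1 -> 0 <= x <= 1 -> 0 <= y <= 1 ->
    b * w x + (1 - b) * w y <= w (b * x + (1 - b) * y)) ->
  0 <= b <= 1 -> 0 <= x <= 1 -> 0 <= y <= 1 -> y <= x ->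
  Num.min (q0 (b * x + (1 - b) * y)) (q1 (b * x + (1 - b) * y)) <=
    (1 - b) * lambda + b * Num.min (q0 x) (q1 x) + (1 - b) * Num.min (q0 y) (q1 y).
Proof.
move=> w_conc hb hx hy yx; set z := b * x + (1 - b) * y.
have /andP[b0 b1] := hb; have b'0 : 0 <= 1 - b by rewrite subr_ge0.
have bl : 0 <= (1 - b) * lambda by rewrite mulr_ge0.
have /andP[x0 x1] := hx; have /andP[y0 y1] := hy.
have [x01|x10] := ltP (q0 x) (q1 x); last first.
- have [y01|y10] := leP (q0 y) (q1 y).
  + rewrite ge_min; apply/orP; right.
    (* Transmit at [x], wait at [y]: transmit at [z]. The fees cancel, (1 - b) lambda + b lambda =
       lambda, leaving this comparison at [y], which is concavity of [w] between p01 and p11. *)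
    have h : y * r0 + (1 - y) * w p01 <= w (T y).
      apply: le_trans (w_conc y p11 p01 hy p11_itv p01_itv).
      by rewrite lerD2r ler_wpM2l.
    have := ler_wpM2l b'0 (ler_wpM2l beta_ge0 h).
    rewrite -subr_ge0 => h'; rewrite -subr_ge0; apply: le_trans h' _.
    rewrite le_eqVlt; apply/orP; left; apply/eqP; rewrite /q0 /q1.
    rewrite /z; ring.
  + rewrite ge_min; apply/orP; right.
    rewrite -subr_ge0; apply: le_trans bl _.
    by rewrite le_eqVlt; apply/orP; left; apply/eqP; rewrite /z /q1; ring.
- have [y01|y10] := leP (q0 y) (q1 y).
  + rewrite ge_min; apply/orP; left.
    (* Wait at both: wait at [z], using (C) for [w]; discounting only shrinks its fee. *)
    have TzE : T z = b * T x + (1 - b) * T y by rewrite /z /belief_update; ring.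
    have h : w (T z) <= (1 - b) * lambda + b * w (T x) + (1 - b) * w (T y).
      rewrite TzE; apply: w_conv => //.
      * exact: belief_update_itv.
      * exact: belief_update_itv.
      * exact: le_belief_update.
    have h1 := ler_wpM2l beta_ge0 h.
    have h2 : beta * ((1 - b) * lambda) <= (1 - b) * lambda.
      by rewrite ler_piMl.
    rewrite /q0; lra.
  (* Transmitting strictly better at [y] but waiting strictly better at [x]: impossible, since [y]
     is positive by [q0_le_q1_at0]. *)
  + have yn0 : 0 < y.
      rewrite lt_neqAle y0 andbT; apply: contraTneq y10 => <-.
      by rewrite -leNgt q0_le_q1_at0.
    exfalso; have := transmit_monotone _ _ yn0 yx x1 (ltW y10).
    by rewrite leNgt x01.
Qed.

(** A minimum of concave functions: [q0] is concave after an affine map and [q1] is affine. *)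
Lemma min_q_conc b x y :
  (forall b x y, 0 <= b <= 1 -> 0 <= x <= 1 -> 0 <= y <= 1 ->
    b * w x + (1 - b) * w y <= w (b * x + (1 - b) * y)) ->
  0 <= b <= 1 -> 0 <= x <= 1 -> 0 <= y <= 1 ->
  b * Num.min (q0 x) (q1 x) + (1 - b) * Num.min (q0 y) (q1 y) <=
  Num.min (q0 (b * x + (1 - b) * y)) (q1 (b * x + (1 - b) * y)).
Proof.
move=> w_conc hb hx hy; set z := b * x + (1 - b) * y.
have /andP[b0 b1] := hb; have b'0 : 0 <= 1 - b by rewrite subr_ge0.
rewrite le_min; apply/andP; split.
- apply: (@le_trans _ _ (b * q0 x + (1 - b) * q0 y)).
    by apply: lerD; apply: ler_wpM2l => //; rewrite ge_min lexx.
  have TzE : T z = b * T x + (1 - b) * T y by rewrite /z /belief_update; ring.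
  have := w_conc b (T x) (T y) hb (belief_update_itv _ hx) (belief_update_itv _ hy).
  rewrite -TzE => /(ler_wpM2l beta_ge0); rewrite /q0; lra.
- apply: (@le_trans _ _ (b * q1 x + (1 - b) * q1 y)).
    by apply: lerD; apply: ler_wpM2l => //; rewrite ge_min lexx orbT.
  by rewrite le_eqVlt; apply/orP; left; apply/eqP; rewrite /z /q1; ring.
Qed.

(* The threshold is the infimum of the positive beliefs at which transmitting is
   optimal, attained as q0 is antitone and q1 is affine. The belief 0 is left
   out because transmit_monotone says nothing about a tie there. *)
Lemma threshold_exists : exists bstar : R, forall b, 0 <= b <= 1 ->
  (bstar <= b -> q1 b <= q0 b) /\ (b < bstar -> q0 b <= q1 b).
Proof.
pose S := [set b : R | 0 < b <= 1 /\ q1 b <= q0 b].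
have [[b1 Sb1]|S0] := pselect (S !=set0); last first.
  (* Any number above 1 encodes never transmitting. *)
  exists 2 => b /andP[b0 b1]; split; first by move=> h2b; exfalso; lra.
  move=> _; have [->|bn0] := eqVneq b 0; first exact: q0_le_q1_at0.
  rewrite leNgt; apply/negP => h; apply: S0; exists b; split; last exact: ltW.
  by rewrite lt_neqAle eq_sym bn0 b0 b1.
have Slb : has_lbound S by exists 0 => b [/andP[/ltW]].
have hS : has_inf S by split => //; exists b1.
set s := inf S.
have s0 : 0 <= s by apply: lb_le_inf => [|b [/andP[/ltW]]//]; exists b1.
exists s => b hb; have /andP[b0 b1'] := hb; split; last first.
  move=> bs; have [->|bn0] := eqVneq b 0; first exact: q0_le_q1_at0.
  rewrite leNgt; apply/negP => h.
  have : s <= b.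
    apply: ge_inf => //; split; last exact: ltW.
    by rewrite lt_neqAle eq_sym bn0 b0 b1'.
  by rewrite leNgt bs.
rewrite le_eqVlt => /predU1P[sb|sb]; last first.
  have bs0 : 0 < b - s by rewrite subr_gt0.
  have [d [/andP[d0 d1] hd]] := inf_adherent bs0 hS.
  by rewrite -/s subrKC => db; exact: (transmit_monotone b d d0 (ltW db) b1' hd).
rewrite leNgt; apply/negP => hlt.
set D := beta * (w p01 - r0).
have D0 : 0 <= D by rewrite mulr_ge0// subr_ge0 r0_le_w01.
have q1E d : q1 d = q1 b - (d - b) * D by rewrite /q1 /D; ring.
(* Suppose waiting is strictly better at the infimum [b]. For a member [d] of [S] within [eps] of
   it, [q1] drops by less than q1 b - q0 b while [q0] does not increase, so waiting is still better
   at [d]. Adding 1 avoids a division by 0 when [D] vanishes. *)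
pose eps := (q1 b - q0 b) / (D + 1).
have D1 : 0 < D + 1 by lra.
have eps0 : 0 < eps by rewrite divr_gt0// subr_gt0.
have [d Sd dlt] := inf_adherent eps0 hS.
have [/andP[d0 d1] hd] := Sd.
have sd : s <= d by exact: ge_inf.
have q0d : q0 d <= q0 b by apply: q0_anti; rewrite ?(ltW d0)// -sb.
have : q1 b - (d - b) * D <= q0 b by rewrite -q1E; exact: le_trans hd q0d.
rewrite leNgt => /negP; apply.
have h1 : (d - b) * D <= (d - b) * (D + 1).
  by rewrite ler_wpM2l ?lerDl// subr_ge0 -sb.
have h2 : (d - b) * (D + 1) < q1 b - q0 b.
  by rewrite -ltr_pdivlMr// -/eps; move: dlt; rewrite -/s sb; lra.
lra.
Qed.

End belief_action_values.

(** * Structure of the value function *)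

Section folded_bellman.
Context {R : realType}.
Variables (a lambda beta p01 p11 : R).
Hypotheses (lambda_ge0 : 0 <= lambda) (beta_gt0 : 0 < beta) (beta_lt1 : beta < 1).
Hypotheses (p01_gt0 : 0 < p01) (p01_le1 : p01 <= 1).
Hypotheses (p11_gt0 : 0 < p11) (p11_le1 : p11 <= 1).
Hypotheses (ha : a ^+ 2 * (1 - p01) < 1) (hp : p01 <= p11).
Implicit Types (v : R * R -> \bar R) (s : R * R).

Local Notation expect := (expect_next a p01 p11).
Local Notation act := (action_value a lambda beta p01 p11).
Local Notation viter := (value_iter a lambda beta p01 p11).
Local Notation vlim := (value_lim a lambda beta p01 p11).
Local Notation T := (belief_update p01 p11).
Local Notation N01 := (normal_prob (0 : R) 1).

Let beta_ge0 : 0 <= beta := ltW beta_gt0.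
Let beta_le1 : beta <= 1 := ltW beta_lt1.
Let p01_itv : 0 <= p01 <= 1. Proof. by rewrite ltW. Qed.
Let p11_itv : 0 <= p11 <= 1. Proof. by rewrite ltW. Qed.

Definition no_reset v e b : \bar R := folded_expect (fun y => v (y, b)) (a * e).
Definition reset v : \bar R := folded_expect (fun y => v (y, p11)) 0.

Lemma measurable_section v b : measurable_fun setT v ->
  measurable_fun setT (fun y : R => v (y, b)).
Proof. by move=> mv; exact: (measurableT_comp mv (pair2_measurable _)). Qed.

Lemma expect_next_false v e b :
  measurable_fun setT v -> (forall s, 0 <= v s)%E -> 0 <= b <= 1 ->
  expect v (e, b) false = no_reset v e (T b).
Proof.
move=> mv v0 hb; have /andP[b0 b1] := hb.
rewrite /expect_next (giry_int_prod1 _ _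
  (measurable_expect_integrand a p01 p11 v (e, b) false mv) (fun x => v0 _)).
apply: eq_integral => w _; rewrite /giry_int (integral_bernoulli_prob hb (fun x => v0 _))/=.
(* The next state ignores the channel, so the weights b and 1 - b add up to 1. *)
by rewrite -ge0_muleDl ?lee_fin ?subr_ge0// -EFinD subrKC mul1e.
Qed.

Lemma expect_next_true v e b :
  measurable_fun setT v -> (forall s, 0 <= v s)%E -> 0 <= b <= 1 ->
  expect v (e, b) true = (b%:E * reset v + (1 - b)%:E * no_reset v e p01)%E.
Proof.
move=> mv v0 hb; have /andP[b0 b1] := hb.
have b'0 : 0 <= 1 - b by rewrite subr_ge0.
rewrite /expect_next (giry_int_prod1 _ _
  (measurable_expect_integrand a p01 p11 v (e, b) true mv) (fun x => v0 _)).
rewrite /reset /no_reset.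
rewrite -folded_expectZ//; last exact: measurable_section.
rewrite -folded_expectZ//; last exact: measurable_section.
have mvw b' x : measurable_fun setT (fun w : R => v (`|x + w|, b')).
  by apply: (measurable_folded (fun y => v (y, b'))); exact: measurable_section.
rewrite /folded_expect -ge0_integralD;
  [|by []|by move=> w _; apply: mule_ge0|by apply: measurable_funeM; exact: mvw
   |by move=> w _; apply: mule_ge0|by apply: measurable_funeM; exact: mvw].
apply: eq_integral => w _; rewrite /giry_int (integral_bernoulli_prob hb (fun x => v0 _))/=.
by rewrite add0r.
Qed.


Lemma action_value_false v e b :
  measurable_fun setT v -> (forall s, 0 <= v s)%E -> 0 <= b <= 1 ->
  act v (e, b) false = ((e ^+ 2)%:E + beta%:E * no_reset v e (T b))%E.
Proof.
by move=> mv v0 hb; rewrite /action_value expect_next_false// mulr0 addr0.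
Qed.

Lemma action_value_true v e b :
  measurable_fun setT v -> (forall s, 0 <= v s)%E -> 0 <= b <= 1 ->
  act v (e, b) true = ((e ^+ 2 + lambda)%:E
    + beta%:E * (b%:E * reset v + (1 - b)%:E * no_reset v e p01))%E.
Proof.
by move=> mv v0 hb; rewrite /action_value expect_next_true// mulr1.
Qed.

Lemma folded_expect_quadratic (f : R -> \bar R) (C1 C2 eps K m : R) :
  measurable_fun setT f -> (forall y, 0 <= f y)%E ->
  0 <= C1 -> 0 <= C2 -> 0 < eps ->
  (\int[N01]_w (w ^+ 2)%:E <= K%:E)%E ->
  (forall y, f y <= (C1 * y ^+ 2 + C2)%:E)%E ->
  (folded_expect f m <=
   (C1 * ((1 + eps) * m ^+ 2 + (1 + eps^-1) * K) + C2)%:E)%E.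
Proof.
move=> mf f0 C10 C20 eps0 hK hf.
have m2 : measurable_fun setT (fun y : R => (y ^+ 2)%:E).
  by apply/measurable_EFinP; exact: exprn_measurable.
have m3 : measurable_fun setT (fun y : R => C1%:E * (y ^+ 2)%:E)%E.
  exact: measurable_funeM.
apply: (@le_trans _ _ (folded_expect ((fun y => C1%:E * (y ^+ 2)%:E) \+ cst C2%:E)%E m)).
  apply: le_folded_expect_fun; [exact: mf|exact: emeasurable_funD|exact: f0|].
  by move=> y _; exact: hf.
rewrite folded_expectD//; last first.
  by move=> x; rewrite -EFinM lee_fin mulr_ge0 ?sqr_ge0.
rewrite folded_expect_cst folded_expectZ//; last by move=> x; rewrite lee_fin sqr_ge0.
rewrite [leRHS]EFinD leeD2r// [leRHS]EFinM lee_wpmul2l//.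
exact: folded_expect_sqr_le.
Qed.

(* Always transmitting: from a belief at least p01, the expected squared error
   is multiplied by at most a^2 (1 - p01) < 1, up to an additive constant. *)
Lemma value_iter_quadratic : exists C1 C2 : R,
  [/\ 0 <= C1, 0 <= C2 & forall n e b, 0 <= b <= 1 ->
     (viter n (e, b) <= (C1 * e ^+ 2 + C2)%:E)%E].
Proof.
have [K K0 hK] := @normal_second_moment_bounded R.
pose q := a ^+ 2 * (1 - p01); have q1 : q < 1 by exact: ha.
have q0 : 0 <= q by rewrite mulr_ge0 ?sqr_ge0// subr_ge0.
(* Small enough that (1 + eps) q < q + (1 - q) = 1. *)
pose eps := (1 - q) / 2.
have eps0 : 0 < eps by rewrite /eps; lra.
pose M := (1 + eps^-1) * K.
have M0 : 0 <= M by rewrite mulr_ge0// addr_ge0// invr_ge0 ltW.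
pose rho := (1 + eps) * q.
have rho1 : rho < 1 by rewrite /rho /eps; nra.
(* [C1] and [C2] are the fixed points of the recursions for the coefficient of e^2 and for the
   constant term ([C1E], [C2E]). *)
pose C1 := (1 - rho)^-1.
have C10 : 0 <= C1 by rewrite invr_ge0 subr_ge0 ltW.
have C1E : 1 + rho * C1 = C1 by rewrite /C1; field; rewrite subr_eq0 gt_eqF.
pose C2 := (lambda + beta * C1 * M) / (1 - beta).
have C20 : 0 <= C2.
  apply: divr_ge0; last by rewrite subr_ge0.
  by apply: addr_ge0 => //; apply: mulr_ge0 => //; exact: mulr_ge0.
have C2E : lambda + beta * (C1 * M + C2) = C2.
  by rewrite /C2; field; rewrite subr_eq0 gt_eqF.
have eps1 : 0 <= 1 + eps by rewrite addr_ge0// ltW.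
pose A := (1 + eps) * a ^+ 2 * C1.
have A0 : 0 <= A.
  by apply: mulr_ge0 => //; apply: mulr_ge0 => //; exact: sqr_ge0.
have C1A : 1 + (1 - p01) * A = C1 by rewrite -[RHS]C1E /A /rho /q; ring.
have mviter n := measurable_value_iter a lambda beta p01 p11 lambda_ge0 beta_ge0 n.
have viter0 n := value_iter_ge0 a lambda beta p01 p11 lambda_ge0 beta_ge0 n.
(* After a transmission the belief is p01 or p11, so the bound on [viter n] is only required on
   [p01, 1]. *)
have step n e b : 0 <= b <= 1 ->
    (forall y b', p01 <= b' <= 1 -> (viter n (y, b') <= (C1 * y ^+ 2 + C2)%:E)%E) ->
    (viter n.+1 (e, b) <=
      ((1 + (1 - b) * A) * e ^+ 2 + C2)%:E)%E.
  move=> hb hn; have /andP[b0 b1] := hb.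
  have b'0 : 0 <= 1 - b by rewrite subr_ge0.
  have h1 : (reset (viter n) <= (C1 * M + C2)%:E)%E.
    have := folded_expect_quadratic _ C1 C2 eps K 0 (measurable_section _ p11 (mviter n))
      (fun y => viter0 n _) C10 C20 eps0 hK (fun y => hn y p11 _).
    by rewrite expr0n/= mulr0 add0r; apply; rewrite hp.
  have h2 : (no_reset (viter n) e p01 <=
      (C1 * ((1 + eps) * (a * e) ^+ 2 + M) + C2)%:E)%E.
    apply: folded_expect_quadratic => //; first exact: measurable_section.
    by move=> y; apply: hn; rewrite lexx.
  apply: (@le_trans _ _ (act (viter n) (e, b) true)).
    by rewrite value_iterS /bellman ge_min lexx orbT.
  rewrite action_value_true//.
  apply: (@le_trans _ _ ((e ^+ 2 + lambda)%:E
    + beta%:E * (b%:E * (C1 * M + C2)%:E + (1 - b)%:E *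
       (C1 * ((1 + eps) * (a * e) ^+ 2 + M) + C2)%:E))%E).
    by rewrite leeD2l// lee_wpmul2l// leeD// lee_wpmul2l.
  rewrite -!(EFinM, EFinD) lee_fin.
  have h3 : beta * ((1 - b) * A * e ^+ 2) <= (1 - b) * A * e ^+ 2.
    by rewrite ler_piMl// mulr_ge0 ?sqr_ge0// mulr_ge0.
  rewrite -[X in _ <= _ + X]C2E -subr_ge0.
  rewrite -subr_ge0 in h3; apply: le_trans h3 _.
  by rewrite le_eqVlt; apply/orP; left; apply/eqP; rewrite /A; ring.
(* For b >= p01, 1 + (1 - b) A <= 1 + (1 - p01) A = C1, which closes the induction. *)
have bound n e b : p01 <= b <= 1 -> (viter n (e, b) <= (C1 * e ^+ 2 + C2)%:E)%E.
  elim: n e b => [|n IH] e b hb.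
    by rewrite lee_fin addr_ge0// mulr_ge0 ?sqr_ge0.
  have /andP[pb b1] := hb.
  have b0 : 0 <= b by rewrite (le_trans (ltW p01_gt0)).
  apply: le_trans (step n e b _ _) _; rewrite ?b0//.
  rewrite lee_fin lerD2r ler_wpM2r ?sqr_ge0// -[leRHS]C1A lerD2l ler_wpM2r//.
  by rewrite lerB.
(* From an arbitrary belief, one more step costs at most the coefficient 1 + A. *)
exists (1 + A), C2; split=> [||[|n] e b hb] //; first by rewrite addr_ge0.
  by rewrite lee_fin addr_ge0// mulr_ge0 ?sqr_ge0// addr_ge0.
apply: le_trans (step n e b hb (bound n)) _.
rewrite lee_fin lerD2r ler_wpM2r ?sqr_ge0// lerD2l ler_piMl//.
by case/andP: hb => b0 _; rewrite gerBl.
Qed.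


(** These properties are proved for the iterates and then for their limit; the quadratic bound keeps
    the expectations finite. Concavity, kept apart in [belief_concave], accompanies the iterates
    only. *)
Record belief_structure v : Prop := BeliefStructure {
  bs_measurable : measurable_fun setT v ;
  bs_ge0 : forall s, (0 <= v s)%E ;
  bs_quadratic : exists C1 C2 : R, [/\ 0 <= C1, 0 <= C2 &
    forall e b : R, 0 <= b <= 1 -> (v (e, b) <= (C1 * e ^+ 2 + C2)%:E)%E] ;
  bs_error : forall e1 e2 b : R, 0 <= b <= 1 -> 0 <= e1 -> e1 <= e2 ->
    (v (e1, b) <= v (e2, b))%E ;
  bs_belief : forall e b1 b2 : R, 0 <= e -> 0 <= b1 -> b1 <= b2 -> b2 <= 1 ->
    (v (e, b2) <= v (e, b1))%E ;
  bs_conv : forall e x y b : R, 0 <= e -> 0 <= x <= 1 -> 0 <= y <= 1 ->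
    0 <= b <= 1 -> y <= x ->
    (v (e, (b * x + (1 - b) * y)%R) <=
       ((1 - b) * lambda)%:E + b%:E * v (e, x) + (1 - b)%:E * v (e, y))%E }.

Definition belief_concave v : Prop :=
  forall e x y b : R, 0 <= e -> 0 <= x <= 1 -> 0 <= y <= 1 -> 0 <= b <= 1 ->
  (b%:E * v (e, x) + (1 - b)%:E * v (e, y) <= v (e, (b * x + (1 - b) * y)%R))%E.

(** A successful transmission acts as if the error had been 0, so monotonicity in the error compares
    a reset with no reset. *)
Lemma reset_no_reset v : reset v = no_reset v 0 p11.
Proof. by rewrite /reset /no_reset mulr0. Qed.

(** * One Bellman step from a structured continuation value *)

Section structured.
Variable v : R * R -> \bar R.
Hypothesis sv : belief_structure v.

Let mv := bs_measurable v sv.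
Let v0 := bs_ge0 v sv.
Let msv b := measurable_section v b mv.

Lemma no_reset_fin_num e b : 0 <= b <= 1 -> no_reset v e b \is a fin_num.
Proof.
move=> hb; have [C1 [C2 [C10 C20 hC]]] := bs_quadratic v sv.
have [K K0 hK] := @normal_second_moment_bounded R.
rewrite ge0_fin_numE; last exact: folded_expect_ge0.
apply: le_lt_trans (folded_expect_quadratic _ C1 C2 1 K _ (msv b) (fun y => v0 _)
  C10 C20 ltr01 hK (fun y => hC y b hb)) _.
exact: ltry.
Qed.

Lemma le_no_reset_error e1 e2 b : 0 <= b <= 1 -> 0 <= e1 -> e1 <= e2 ->
  (no_reset v e1 b <= no_reset v e2 b)%E.
Proof.
move=> hb e10 e12; apply: le_folded_expect => //.
  by move=> x y x0 xy; exact: (bs_error v sv).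
rewrite !normrM ler_wpM2l// ger0_norm// ger0_norm//.
exact: le_trans e10 e12.
Qed.

Lemma le_no_reset_belief e x y : 0 <= x -> x <= y -> y <= 1 ->
  (no_reset v e y <= no_reset v e x)%E.
Proof.
move=> x0 xy y1; apply: le_folded_expect_fun => // z z0.
exact: (bs_belief v sv).
Qed.

(** Writes a mixture as one expectation, so that pointwise inequalities in the belief can be
    integrated over the next error. *)
Lemma mixture_no_reset e x y b : 0 <= b <= 1 ->
  (b%:E * no_reset v e x + (1 - b)%:E * no_reset v e y =
   folded_expect ((fun z => b%:E * v (z, x)) \+ (fun z => (1 - b)%:E * v (z, y)))
     (a * e))%E.
Proof.
move=> /andP[b0 b1]; have b'0 : 0 <= 1 - b by rewrite subr_ge0.
rewrite folded_expectD; [|exact: measurable_funeM..|by move=> z; apply: mule_ge0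
  |by move=> z; apply: mule_ge0].
by rewrite !folded_expectZ.
Qed.

Lemma no_reset_conv e x y b : 0 <= x <= 1 -> 0 <= y <= 1 ->
  0 <= b <= 1 -> y <= x ->
  (no_reset v e (b * x + (1 - b) * y)%R <=
     ((1 - b) * lambda)%:E + b%:E * no_reset v e x + (1 - b)%:E * no_reset v e y)%E.
Proof.
move=> hx hy hb yx; rewrite -addeA mixture_no_reset//.
have /andP[b0 b1] := hb; have b'0 : 0 <= 1 - b by rewrite subr_ge0.
have mm : measurable_fun setT
    ((fun z => b%:E * v (z, x)) \+ (fun z => (1 - b)%:E * v (z, y)))%E.
  by apply: emeasurable_funD; exact: measurable_funeM.
have l0 : (0 <= ((1 - b) * lambda)%:E)%E by rewrite lee_fin mulr_ge0.
have mm0 z : (0 <= ((fun z => b%:E * v (z, x)) \+ (fun z => (1 - b)%:E * v (z, y))) z)%E.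
  by apply: adde_ge0; apply: mule_ge0.
rewrite -[X in (X + _)%E](folded_expect_cst ((1 - b) * lambda)%:E (a * e)).
rewrite -folded_expectD//.
apply: le_folded_expect_fun; [exact: msv|exact: emeasurable_funD|by []|].
by move=> z z0; rewrite /= addeA; exact: (bs_conv v sv).
Qed.

Lemma no_reset_conc e x y b : belief_concave v -> 0 <= x <= 1 -> 0 <= y <= 1 ->
  0 <= b <= 1 ->
  (b%:E * no_reset v e x + (1 - b)%:E * no_reset v e y <=
     no_reset v e (b * x + (1 - b) * y)%R)%E.
Proof.
move=> cv hx hy hb; rewrite mixture_no_reset//.
have /andP[b0 b1] := hb; have b'0 : 0 <= 1 - b by rewrite subr_ge0.
apply: le_folded_expect_fun; [|exact: msv| |].
- by apply: emeasurable_funD; exact: measurable_funeM.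
- by move=> z; apply: adde_ge0; apply: mule_ge0.
- by move=> z z0; exact: cv.
Qed.

(** A real version for the section on action values, meaningful at beliefs in [0, 1], where
    [no_reset_fin_num] applies. *)
Definition no_reset_real e b : R := fine (no_reset v e b).
Definition reset_real : R := fine (reset v).
Local Notation w := no_reset_real.
Local Notation r0 := reset_real.

Lemma no_reset_realE e b : 0 <= b <= 1 -> (w e b)%:E = no_reset v e b.
Proof. by move=> hb; rewrite /no_reset_real fineK// no_reset_fin_num. Qed.

Lemma reset_realE : r0%:E = no_reset v 0 p11.
Proof. by rewrite -reset_no_reset /reset_real fineK// reset_no_reset no_reset_fin_num. Qed.

Lemma no_reset_real_anti e x y : 0 <= x <= 1 -> 0 <= y <= 1 -> x <= y ->
  w e y <= w e x.
Proof.
move=> hx hy xy; rewrite -lee_fin.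
rewrite (no_reset_realE e y hy) (no_reset_realE e x hx).
by apply: le_no_reset_belief => //; [case/andP: hx|case/andP: hy].
Qed.

Lemma no_reset_real_conv e b x y : 0 <= b <= 1 -> 0 <= x <= 1 -> 0 <= y <= 1 ->
  y <= x -> w e (b * x + (1 - b) * y) <=
    (1 - b) * lambda + b * w e x + (1 - b) * w e y.
Proof.
move=> hb hx hy yx; rewrite -lee_fin !EFinD (EFinM b) (EFinM (1 - b) (w e y)).
by rewrite !no_reset_realE//; [exact: no_reset_conv|exact: conv_itv01].
Qed.

Lemma no_reset_real_conc e b x y : belief_concave v ->
  0 <= b <= 1 -> 0 <= x <= 1 -> 0 <= y <= 1 ->
  b * w e x + (1 - b) * w e y <= w e (b * x + (1 - b) * y).
Proof.
move=> cv hb hx hy; rewrite -lee_fin EFinD !EFinM.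
by rewrite !no_reset_realE//; [exact: no_reset_conc|exact: conv_itv01].
Qed.

Lemma reset_real_le e : 0 <= e -> r0 <= w e p11.
Proof.
move=> e0; rewrite -lee_fin reset_realE no_reset_realE//.
exact: le_no_reset_error.
Qed.

Lemma action_value_false_real e b : 0 <= b <= 1 ->
  act v (e, b) false = (e ^+ 2 + beta * w e (T b))%:E.
Proof.
move=> hb; rewrite action_value_false// EFinD (EFinM beta) no_reset_realE//.
exact: belief_update_itv.
Qed.

Lemma action_value_true_real e b : 0 <= b <= 1 ->
  act v (e, b) true =
  (e ^+ 2 + lambda + beta * (b * r0 + (1 - b) * w e p01))%:E.
Proof.
move=> hb; rewrite action_value_true//.
by rewrite reset_no_reset -reset_realE -no_reset_realE//.
Qed.

Lemma bellman_real e b : 0 <= b <= 1 ->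
  bellman a lambda beta p01 p11 v (e, b) =
  (Num.min (e ^+ 2 + beta * w e (T b))
     (e ^+ 2 + lambda + beta * (b * r0 + (1 - b) * w e p01)))%:E.
Proof.
by move=> hb; rewrite /bellman action_value_false_real// action_value_true_real// EFin_min.
Qed.


(** The quadratic bound is a premise because [value_iter_quadratic] supplies it with constants
    common to all iterates, as the limit requires. *)
Lemma bellman_structure : belief_concave v ->
  (exists C1 C2 : R, [/\ 0 <= C1, 0 <= C2 & forall e b : R, 0 <= b <= 1 ->
    (bellman a lambda beta p01 p11 v (e, b) <= (C1 * e ^+ 2 + C2)%:E)%E]) ->
  belief_structure (bellman a lambda beta p01 p11 v) /\
  belief_concave (bellman a lambda beta p01 p11 v).
Proof.
move=> cv hquad; split; last first.
  move=> e x y b e0 hx hy hb.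
  rewrite !bellman_real//; last exact: conv_itv01.
  rewrite -!EFinM -EFinD lee_fin.
  apply: (min_q_conc lambda beta p01 p11 (w e) r0 (e ^+ 2) beta_ge0 p01_itv p11_itv) => //.
  by move=> *; exact: no_reset_real_conc.
split.
- apply: measurable_mine; exact: measurable_action_value.
- by move=> s; rewrite le_min !action_value_ge0.
- exact: hquad.
- move=> e1 e2 b hb e10 e12; have /andP[b0 b1] := hb.
  have b'0 : 0 <= 1 - b by rewrite subr_ge0.
  have e20 := le_trans e10 e12.
  have mw x : 0 <= x <= 1 -> w e1 x <= w e2 x.
    move=> hx; rewrite -lee_fin (no_reset_realE e1 x hx) (no_reset_realE e2 x hx).
    exact: le_no_reset_error.
  have e2le : e1 ^+ 2 <= e2 ^+ 2 by rewrite lerXn2r ?nnegrE.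
  rewrite !bellman_real// lee_fin; apply: le_min2.
    by rewrite lerD// ler_wpM2l// mw// belief_update_itv.
  by rewrite lerD ?lerD// ler_wpM2l// lerD2l ler_wpM2l// mw.
- move=> e b1 b2 e0 b10 b12 b21.
  have hb1 : 0 <= b1 <= 1 by rewrite b10 (le_trans b12).
  have hb2 : 0 <= b2 <= 1 by rewrite b21 (le_trans b10).
  rewrite !bellman_real// lee_fin; apply: le_min2.
    exact: (q0_anti beta p01 p11 (w e) (e ^+ 2) beta_ge0 p01_itv p11_itv hp
      (no_reset_real_anti e)).
  exact: (q1_anti lambda beta p01 p11 (w e) r0 (e ^+ 2) beta_ge0 p01_itv p11_itv hp
    (no_reset_real_anti e) (reset_real_le e e0)).
- move=> e x y b e0 hx hy hb yx.
  rewrite !bellman_real//; last exact: conv_itv01.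
  rewrite -!EFinM -!EFinD lee_fin.
  apply: (min_q_conv lambda beta p01 p11 (w e) r0 (e ^+ 2) lambda_ge0 beta_ge0 beta_le1
    p01_itv p11_itv hp (no_reset_real_conv e) (reset_real_le e e0)) => //.
  by move=> *; exact: no_reset_real_conc.
Qed.

Lemma threshold_structure e : 0 <= e -> exists bstar : R, forall b : R, 0 <= b <= 1 ->
  (bstar <= b -> (act v (e, b) true <= act v (e, b) false)%E) /\
  (b < bstar -> (act v (e, b) false <= act v (e, b) true)%E).
Proof.
move=> e0.
have [bstar h] := threshold_exists lambda beta p01 p11 (w e) r0 (e ^+ 2)
  lambda_ge0 beta_ge0 beta_le1 p01_itv p11_itv hp
  (no_reset_real_anti e) (no_reset_real_conv e) (reset_real_le e e0).
exists bstar => b hb; rewrite action_value_false_real// action_value_true_real// !lee_fin.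
exact: h.
Qed.

End structured.

Lemma value_iter_structure n :
  belief_structure (viter n) /\ belief_concave (viter n).
Proof.
have [C1 [C2 [C10 C20 hC]]] := value_iter_quadratic.
elim: n => [|n [sn cn]]; last first.
  rewrite value_iterS; apply: bellman_structure => //.
  by exists C1, C2; split=> // e b hb; exact: (hC n.+1).
split; last by move=> e x y b e0 hx hy hb; rewrite !mule0 adde0.
split.
- exact: (measurable_value_iter a lambda beta p01 p11 lambda_ge0 beta_ge0 0).
- by [].
- by exists 0, 0; split=> // e b hb; rewrite mul0r addr0.
- by [].
- by [].
- move=> e x y b e0 hx hy /andP[b0 b1] yx; rewrite !mule0 !adde0 lee_fin.
  by rewrite mulr_ge0// subr_ge0.
Qed.

(** In each inequality the left iterate is bounded by the right side at the same iterate, hence by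
    the right side at the limit; then take the supremum on the left. *)
Lemma value_lim_structure : belief_structure vlim.
Proof.
split.
- exact: measurable_value_lim.
- exact: value_lim_ge0.
- have [C1 [C2 [C10 C20 hC]]] := value_iter_quadratic.
  by exists C1, C2; split=> // e b hb; apply: value_lim_le => n; exact: hC.
- move=> e1 e2 b hb e10 e12; apply: value_lim_le => n.
  apply: le_trans (value_iter_le_lim _ _ _ _ _ n _).
  by apply: (bs_error _ (value_iter_structure n).1).
- move=> e b1 b2 e0 b10 b12 b21; apply: value_lim_le => n.
  apply: le_trans (value_iter_le_lim _ _ _ _ _ n _).
  by apply: (bs_belief _ (value_iter_structure n).1).
- move=> e x y b e0 hx hy hb yx; apply: value_lim_le => n.
  apply: le_trans (bs_conv _ (value_iter_structure n).1 e x y b e0 hx hy hb yx) _.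
  have /andP[b0 b1] := hb.
  by rewrite !leeD ?lee_wpmul2l ?value_iter_le_lim ?lee_fin ?subr_ge0.
Qed.

(** Matches the density formulas of [Qvalue] with the noise expectations of value iteration; the
    reset is the case of mean 0, where the two densities add up to 2 phi. *)
Lemma QvalueE e b u : 0 <= b <= 1 ->
  Qvalue a lambda beta p01 p11 e b u = act vlim (e, b) u.
Proof.
move=> hb; have /andP[b0 b1] := hb.
have b'0 : 0 <= 1 - b by rewrite subr_ge0.
have mv := bs_measurable _ value_lim_structure.
have v0 := bs_ge0 _ value_lim_structure.
have no_resetE b' : (\int[lebesgue_measure]_(y in `[0%R, +oo[)
    ((phi (y - a * e) + phi (y + a * e))%:E
      * value a lambda beta p01 p11 y b'))%E = no_reset vlim e b'.
  rewrite /no_reset (folded_expectE _ _ (measurable_section _ b' mv) (fun y => v0 _)).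
  by apply: eq_integral => y _; rewrite valueE.
have resetE : (\int[lebesgue_measure]_(y in `[0%R, +oo[)
    ((2 * phi y)%:E * value a lambda beta p01 p11 y p11))%E = reset vlim.
  rewrite /reset (folded_expectE _ _ (measurable_section _ p11 mv) (fun y => v0 _)).
  by apply: eq_integral => y _; rewrite valueE// subr0 addr0 mulr_natl mulr2n.
have R0 : (0 <= reset vlim)%E by exact: folded_expect_ge0.
have W0 : (0 <= no_reset vlim e p01)%E by exact: folded_expect_ge0.
rewrite /Qvalue; case: u.
  have bR0 : (0 <= b%:E * reset vlim)%E by exact: mule_ge0.
  have bW0 : (0 <= (1 - b)%:E * no_reset vlim e p01)%E by exact: mule_ge0.
  rewrite resetE no_resetE (action_value_true _ e b mv v0 hb) (ge0_muleDr _ bR0 bW0).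
  by rewrite (EFinM _ b) (EFinM _ (1 - b)) -!muleA addeA.
by rewrite no_resetE (action_value_false _ e b mv v0 hb).
Qed.

End folded_bellman.

Theorem mainTheorem5 (R : realType) (a lambda beta p01 p11 : R)
    (lambda_ge0 : 0 <= lambda) (beta_gt0 : 0 < beta) (beta_lt1 : beta < 1)
    (p01_gt0 : 0 < p01) (p01_le1 : p01 <= 1)
    (p11_gt0 : 0 < p11) (p11_le1 : p11 <= 1)
    (ha : a ^+ 2 * (1 - p01) < 1) (hp : p01 <= p11) :
  let V := value a lambda beta p01 p11 in
  let optimal := optimal_action a lambda beta p01 p11 in
  [/\ (forall b : R, 0 <= b <= 1 ->
        forall e1 e2 : R, 0 <= e1 -> e1 <= e2 -> (V e1 b <= V e2 b)%E),
      (forall e : R, 0 <= e ->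
        forall b1 b2 : R, 0 <= b1 -> b1 <= b2 -> b2 <= 1 ->
        (V e b2 <= V e b1)%E),
      (forall e x y z b : R, 0 <= e ->
        0 <= x <= 1 -> 0 <= y <= 1 -> 0 <= z <= 1 -> 0 <= b <= 1 ->
        y <= x -> z = b * x + (1 - b) * y ->
        (V e z <= ((1 - b) * lambda)%:E + b%:E * V e x
                    + (1 - b)%:E * V e y)%E)
    &      (forall e : R, 0 <= e ->
        exists bstar : R, forall b : R, 0 <= b <= 1 ->
          (bstar <= b -> optimal e b true) /\
          (b < bstar -> optimal e b false))].
Proof.
move=> V optimal.
have VE e b : V e b = value_lim a lambda beta p01 p11 (e, b).
  by apply: valueE => //; exact: ltW.
have sV : belief_structure lambda (value_lim a lambda beta p01 p11).
  exact: value_lim_structure.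
split.
- by move=> b hb e1 e2 e10 e12; rewrite !VE; exact: (bs_error _ _ sV).
- by move=> e e0 b1 b2 b10 b12 b21; rewrite !VE; exact: (bs_belief _ _ sV).
- by move=> e x y z b e0 hx hy _ hb yx ->; rewrite !VE; exact: (bs_conv _ _ sV).
move=> e e0.
have [bstar h] : exists bstar : R, forall b, 0 <= b <= 1 -> _ :=
  threshold_structure a lambda beta p01 p11 lambda_ge0 beta_gt0 beta_lt1
    p01_gt0 p01_le1 p11_gt0 p11_le1 hp _ sV e e0.
exists bstar => b hb; have [h1 h0] := h b hb.
have QE u : Qvalue a lambda beta p01 p11 e b u =
    action_value a lambda beta p01 p11 (value_lim a lambda beta p01 p11) (e, b) u.
  exact: QvalueE.
split=> [/h1|/h0] hle v; rewrite !QE; case: v.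
- exact: lexx.
- exact: hle.
- exact: hle.
- exact: lexx.
Qed.
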